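(* Consider the stochastic system, stage cost and risk-averse constraints of the context, and let $(\mathbf{X}^s,\mathbf{U}^s)$ be a stationary pair with $|\ell(\mathbf{X}^s,\mathbf{U}^s)|<\infty$. Assume that the stochastic optimal control problem is stochastically dissipative at $(\mathbf{X}^s,\mathbf{U}^s)$. Then $$\liminf_{L\to\infty}\frac1L\sum_{k=0}^{L-1}\ell(X_{\mathbf{U}}(k,X_0),U(k))\ \ge\ \ell(\mathbf{X}^s,\mathbf{U}^s)$$ for all initial states $X_0$ and control sequences $\mathbf{U}=(U(0),U(1),\ldots)$ such that, for all $k\in\mathbb{N}_0$, $\sigma(U(k))\subseteq\mathcal{F}_k$ and $\rho(c_i^\top X_{\mathbf{U}}(k,X_0))\le p_i$ $(i=1,\ldots,m_x)$, $\rho(d_i^\top U(k))\le q_i$ $(i=1,\ldots,m_u)$.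
   Context: Setting. $(\Omega,\mathcal{F},\mathbb{P})$ is a probability space and $\mathcal{R}(\Omega,\mathcal{Y})$ is the set of $\mathcal{Y}$-valued random variables. $A\in\mathbb{R}^{n\times n}$, $B\in\mathbb{R}^{n\times l}$, $(A,B)$ controllable. The system is $X(k+1)=AX(k)+BU(k)+W(k)$, $X(0)=X_0\in\mathcal{R}(\Omega,\mathbb{R}^n)$, with $W(0),W(1),\ldots$ i.i.d. $\mathbb{R}^n$-valued random variables, $\mathcal{F}_k=\sigma(X(0),\ldots,X(k))$, adapted controls ($\sigma(U(k))\subseteq\mathcal{F}_k$), and $W(k)$ independent of $X(k)$ and $U(k)$. $X_{\mathbf{U}}(k,X_0)$ denotes the solution at time $k$ for control sequence $\mathbf{U}$ and initial state $X_0$. The stage cost is $\ell(X,U)=\mathbb{E}[g(X,U)]$ with $g:\mathbb{R}^n\times\mathbb{R}^l\to\mathbb{R}$ continuous and bounded from below. Constraints. $\rho:\mathcal{R}(\Omega,\mathbb{R})\to\mathbb{R}\cup\{+\infty\}$ is translative ($\rho(Y+c)=\rho(Y)+c$, $c\in\mathbb{R}$), monotone ($\rho(Y_1)\ge\rho(Y_2)$ if $Y_1\ge Y_2$ a.s.) and law-invariant. The constraints are $\rho(c_i^\top X(k))\le p_i$ ($i=1,\ldots,m_x$) and $\rho(d_i^\top U(k))\le q_i$ ($i=1,\ldots,m_u$), with $c_i\in\mathbb{R}^n$, $d_i\in\mathbb{R}^l$, $p_i,q_i\in\mathbb{R}$. The stochastic optimal control problem is to minimize $\sum_k\ell(X(k),U(k))$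 over adapted control sequences subject to the system dynamics and these constraints at all times. Stationary pair. A pair of processes $(\mathbf{X}^s,\mathbf{U}^s)$ with $X^s(k+1)=AX^s(k)+BU^s(k)+W(k)$ and $U^s(k)=\pi^s(X^s(k))$ for a feedback map $\pi^s$ is stationary if $X^s(k)$, $U^s(k)$ satisfy the constraints for all $k$ and there are probability distributions $P^s_X,P^s_U,P^s_{X,U}$ with $X^s(k)\sim P^s_X$, $U^s(k)\sim P^s_U$, $(X^s(k),U^s(k))\sim P^s_{X,U}$ for all $k\in\mathbb{N}_0$. Then $\ell(\mathbf{X}^s,\mathbf{U}^s)$ denotes the ($k$-independent) value $\ell(X^s(k),U^s(k))$. Stochastic dissipativity. The problem is stochastically dissipative at a stationary pair $(\mathbf{X}^s,\mathbf{U}^s)$ with $|\ell(\mathbf{X}^s,\mathbf{U}^s)|<\infty$ if there exists a law-invariant function $\lambda:\mathcal{R}(\Omega,\mathbb{R}^n)\to\mathbb{R}$, bounded from below, such that $\ell(X(k),U(k))-\ell(\mathbf{X}^s,\mathbf{U}^s)+\lambda(X(k))-\lambda(AX(k)+BU(k)+W(k))\ge0$ for all $k\in\mathbb{N}_0$ and all $X(k),U(k)$ satisfying the adaptedness condition and the constraints. *)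

(* Defs.v *)
From HB Require Import structures.
From mathcomp Require Import all_boot all_order all_algebra.
From mathcomp Require Import finmap.
From mathcomp Require Import all_classical all_reals all_analysis.
From mathcomp Require Import measurable_realfun.

Set Implicit Arguments.
Unset Strict Implicit.
Unset Printing Implicit Defensive.

Import Order.TTheory GRing.Theory Num.Theory.
Import numFieldNormedType.Exports.

Local Open Scope classical_set_scope.
Local Open Scope ring_scope.

(* Matrices carry the sigma-algebra generated by the entries; on 'cV[R]_n this
   is the Borel sigma-algebra of R^n. *)
Section matrix_measurable.
Context {d : measure_display} {T : measurableType d}.
Variables m n : nat.

Definition matrix_entries_preimages : set (set 'M[T]_(m, n)) :=
  \bigcup_(ij : 'I_m * 'I_n)
    preimage_set_system setT (fun M : 'M[T]_(m, n) => M ij.1 ij.2) measurable.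

Definition matrix_measurable : set (set 'M[T]_(m, n)) :=
  <<s matrix_entries_preimages >>.

Let matrix_measurable0 : matrix_measurable set0.
Proof. exact: sigma_algebra0. Qed.

Let matrix_measurableC A : matrix_measurable A -> matrix_measurable (~` A).
Proof. exact: sigma_algebraC. Qed.

Let matrix_measurable_bigcup (F : (set 'M[T]_(m, n))^nat) :
  (forall i, matrix_measurable (F i)) -> matrix_measurable (\bigcup_i F i).
Proof. exact: sigma_algebra_bigcup. Qed.

HB.instance Definition _ := @isMeasurable.Build d 'M[T]_(m, n)
  matrix_measurable matrix_measurable0 matrix_measurableC
  matrix_measurable_bigcup.

Lemma measurable_matrix_entry (i : 'I_m) (j : 'I_n) :
  measurable_fun setT (fun M : 'M[T]_(m, n) => M i j).
Proof.
move=> _ A mA; rewrite setTI; apply: sub_sigma_algebra.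
by exists (i, j) => //; exists A => //; rewrite setTI.
Qed.

Lemma measurable_fun_matrixP d' (S : measurableType d')
    (f : S -> 'M[T]_(m, n)) :
  measurable_fun setT f <->
  forall i j, measurable_fun setT (fun x => f x i j).
Proof.
split=> [mf i j|mf]; first exact: measurableT_comp (measurable_matrix_entry i j) mf.
apply: (measurability matrix_entries_preimages) => //.
move=> _ [_ [[i j] _ [A mA <-]] <-].
by rewrite !setTI; have := mf i j measurableT A mA; rewrite setTI.
Qed.

End matrix_measurable.

Section matrix_measurable_fun.
Context {d : measure_display} {T : measurableType d} {R : realType}.

Lemma measurable_fun_addmx (m n : nat) (f g : T -> 'M[R]_(m, n)) :
  measurable_fun setT f -> measurable_fun setT g ->
  measurable_fun setT (fun x => f x + g x).
Proof.
move=> /measurable_fun_matrixP mf /measurable_fun_matrixP mg.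
apply/measurable_fun_matrixP => i j.
under eq_fun do rewrite mxE.
exact: measurable_funD.
Qed.

Lemma measurable_fun_mulmx (m n p : nat) (A : 'M[R]_(m, n))
    (f : T -> 'M[R]_(n, p)) :
  measurable_fun setT f -> measurable_fun setT (fun x => A *m f x).
Proof.
move=> /measurable_fun_matrixP mf; apply/measurable_fun_matrixP => i j.
under eq_fun do rewrite mxE.
apply: measurable_sum => k; apply: measurable_funM => //.
Qed.

End matrix_measurable_fun.

Section random_variables.
Context {d : measure_display} {T : measurableType d} {R : realType}
  (P : probability T R).

Section pair.
Context {d1 d2 : measure_display} {V1 : measurableType d1}
  {V2 : measurableType d2} (X : {RV P >-> V1}) (Y : {RV P >-> V2}).

Definition rv_pair_fun (w : T) : V1 * V2 := (X w, Y w).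

Let measurable_rv_pair : measurable_fun setT rv_pair_fun.
Proof. exact: measurable_fun_pair. Qed.

HB.instance Definition _ :=
  isMeasurableFun.Build _ _ _ _ rv_pair_fun measurable_rv_pair.

Definition rv_pair : {RV P >-> (V1 * V2)%type} := rv_pair_fun.

End pair.

Section shift.
Variables (Y : {RV P >-> R}) (a : R).

Definition rv_shift_fun (w : T) : R := Y w + a.

Let measurable_rv_shift : measurable_fun setT rv_shift_fun.
Proof. exact: measurable_funD. Qed.

HB.instance Definition _ :=
  isMeasurableFun.Build _ _ _ _ rv_shift_fun measurable_rv_shift.

Definition rv_shift : {RV P >-> R} := rv_shift_fun.

End shift.

Section dot.
Variables (n : nat) (a : 'cV[R]_n) (X : {RV P >-> 'cV[R]_n}).

Definition rv_dot_fun (w : T) : R := (a^T *m X w) 0 0.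

Let measurable_rv_dot : measurable_fun setT rv_dot_fun.
Proof.
have /measurable_fun_matrixP : measurable_fun setT (fun w => a^T *m X w).
  exact: measurable_fun_mulmx.
exact.
Qed.

HB.instance Definition _ :=
  isMeasurableFun.Build _ _ _ _ rv_dot_fun measurable_rv_dot.

Definition rv_dot : {RV P >-> R} := rv_dot_fun.

End dot.

Section step.
Variables (n l : nat) (A : 'M[R]_n) (B : 'M[R]_(n, l)).
Variables (X : {RV P >-> 'cV[R]_n}) (U : {RV P >-> 'cV[R]_l})
  (W : {RV P >-> 'cV[R]_n}).

Definition rv_step_fun (w : T) : 'cV[R]_n := A *m X w + B *m U w + W w.

Let measurable_rv_step : measurable_fun setT rv_step_fun.
Proof.
do 2?[apply: measurable_fun_addmx => //]; exact: measurable_fun_mulmx.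
Qed.

HB.instance Definition _ :=
  isMeasurableFun.Build _ _ _ _ rv_step_fun measurable_rv_step.

Definition rv_step : {RV P >-> 'cV[R]_n} := rv_step_fun.

End step.

Section laws.
Context {d' : measure_display} {V : measurableType d'}.

Definition has_law (Y : {RV P >-> V}) (Q : set V -> \bar R) :=
  forall A, measurable A -> distribution P Y A = Q A.

Definition law_invariant (S : Type) (f : {RV P >-> V} -> S) :=
  forall Y1 Y2, has_law Y1 (distribution P Y2) -> f Y1 = f Y2.

Definition mutually_independent (W : nat -> {RV P >-> V}) :=
  forall (J : {fset nat}) (A : nat -> set V), (forall k, measurable (A k)) ->
    P (\bigcap_(k in [set` J]) W k @^-1` A k) =
    \big[*%E/1%E]_(k <- J) P (W k @^-1` A k).

Definition iid (W : nat -> {RV P >-> V}) :=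
  mutually_independent W /\ forall k, has_law (W k) (distribution P (W 0%N)).

(* sigma(X 0, ..., X k) *)
Definition natural_filtration (X : nat -> {RV P >-> V}) (k : nat) :
    set (set T) :=
  <<s \bigcup_(j in [set j | (j <= k)%N]) g_sigma_algebra_preimage (X j) >>.

End laws.

Definition independent {d1 d2 : measure_display} {V1 : measurableType d1}
    {V2 : measurableType d2} (X : {RV P >-> V1}) (Y : {RV P >-> V2}) :=
  forall A B, measurable A -> measurable B ->
    P (X @^-1` A `&` Y @^-1` B) = (P (X @^-1` A) * P (Y @^-1` B))%E.

Definition adapted {d1 d2 : measure_display} {V1 : measurableType d1}
    {V2 : measurableType d2} (X : nat -> {RV P >-> V1})
    (U : nat -> {RV P >-> V2}) :=
  forall k, g_sigma_algebra_preimage (U k) `<=` natural_filtration X k.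

Definition translative (rho : {RV P >-> R} -> \bar R) :=
  forall Y a, rho (rv_shift Y a) = (rho Y + a%:E)%E.

Definition monotone_risk (rho : {RV P >-> R} -> \bar R) :=
  forall Y1 Y2 : {RV P >-> R},
    {ae P, forall w, Y2 w <= Y1 w} -> (rho Y2 <= rho Y1)%E.

End random_variables.

Section control.
Context {R : realType} {n l : nat} (A : 'M[R]_n) (B : 'M[R]_(n, l)).

Fixpoint deterministic_state (x0 : 'cV[R]_n) (u : nat -> 'cV[R]_l) (k : nat) :
    'cV[R]_n :=
  if k is k'.+1 then A *m deterministic_state x0 u k' + B *m u k' else x0.

Definition controllable :=
  forall x0 x1 : 'cV[R]_n, exists N u, deterministic_state x0 u N = x1.

Context {d : measure_display} {T : measurableType d} (P : probability T R).
Variable W : nat -> {RV P >-> 'cV[R]_n}.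

Fixpoint state (X0 : {RV P >-> 'cV[R]_n}) (U : nat -> {RV P >-> 'cV[R]_l})
    (k : nat) : {RV P >-> 'cV[R]_n} :=
  if k is k'.+1 then rv_step A B (state X0 U k') (U k') (W k') else X0.

Definition noise_independent (X : nat -> {RV P >-> 'cV[R]_n})
    (U : nat -> {RV P >-> 'cV[R]_l}) :=
  forall k, independent (W k) (rv_pair (X k) (U k)).

Definition system_process (X : nat -> {RV P >-> 'cV[R]_n})
    (U : nat -> {RV P >-> 'cV[R]_l}) :=
  [/\ forall k, X k.+1 = rv_step A B (X k) (U k) (W k),
      adapted X U & noise_independent X U].

Definition stage_cost (g : 'cV[R]_n * 'cV[R]_l -> R) (X : {RV P >-> 'cV[R]_n})
    (U : {RV P >-> 'cV[R]_l}) : \bar R :=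
  'E_P[g \o rv_pair X U].

Variables (rho : {RV P >-> R} -> \bar R) (mx mu : nat).
Variables (c : 'I_mx -> 'cV[R]_n) (p : 'I_mx -> R).
Variables (e : 'I_mu -> 'cV[R]_l) (q : 'I_mu -> R).

Definition constraints (X : {RV P >-> 'cV[R]_n}) (U : {RV P >-> 'cV[R]_l}) :=
  (forall i, (rho (rv_dot (c i) X) <= (p i)%:E)%E) /\
  (forall i, (rho (rv_dot (e i) U) <= (q i)%:E)%E).

Definition stationary_pair (Xs : nat -> {RV P >-> 'cV[R]_n})
    (Us : nat -> {RV P >-> 'cV[R]_l}) :=
  [/\ system_process Xs Us,
      exists pi : 'cV[R]_n -> 'cV[R]_l, forall k w, Us k w = pi (Xs k w),
      forall k, constraints (Xs k) (Us k) &
      exists (PX : probability 'cV[R]_n R) (PU : probability 'cV[R]_l R)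
             (PXU : probability ('cV[R]_n * 'cV[R]_l)%type R),
        forall k, [/\ has_law (Xs k) PX, has_law (Us k) PU &
                      has_law (rv_pair (Xs k) (Us k)) PXU] ].

(* For a stationary pair the value does not depend on the time, so that it can
   be read off at time 0. *)
Definition stationary_cost (g : 'cV[R]_n * 'cV[R]_l -> R)
    (Xs : nat -> {RV P >-> 'cV[R]_n}) (Us : nat -> {RV P >-> 'cV[R]_l}) :
    \bar R :=
  stage_cost g (Xs 0%N) (Us 0%N).

Definition dissipative_at (g : 'cV[R]_n * 'cV[R]_l -> R)
    (Xs : nat -> {RV P >-> 'cV[R]_n}) (Us : nat -> {RV P >-> 'cV[R]_l}) :=
  exists lambda : {RV P >-> 'cV[R]_n} -> R,
    [/\ law_invariant lambda,
        exists M : R, forall X, M <= lambda X &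
        forall X U, system_process X U ->
          forall k, constraints (X k) (U k) ->
          (0 <= stage_cost g (X k) (U k) - stationary_cost g Xs Us
                + (lambda (X k))%:E
                - (lambda (rv_step A B (X k) (U k) (W k)))%:E)%E].

End control.

(* Main.v *)
(* Summing the dissipation inequality along the trajectory makes the storage
   terms telescope, so the cost up to time [L] is at least [L] times the
   stationary cost plus a constant, the storage function being bounded below. *)

Require Import Defs.
From mathcomp Require Import all_boot all_order all_algebra.
From mathcomp Require Import all_classical all_reals all_analysis.
From mathcomp Require Import ring lra.

Import Order.TTheory GRing.Theory Num.Theory.
Import numFieldNormedType.Exports.

Local Open Scope classical_set_scope.
Local Open Scope ring_scope.

Lemma le_limn_einf (R : realType) (u v : (\bar R)^nat) :
  (forall n, u n <= v n)%E -> (limn_einf u <= limn_einf v)%E.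
Proof.
move=> uv; rewrite !limn_einf_lim; apply: lee_lim; [exact: is_cvg_einfs..|].
apply: nearW => n; apply: le_ereal_inf_tmp => _ [m /= nm <-].
by apply: le_trans (uv m); apply: ereal_inf_lbound; exists m.
Qed.

(** The mean equals [s + K / L] for positive [L], and [K / L] vanishes in the limit. *)
Lemma cvg_affine_mean (R : realType) (s K : R) :
  (L%:R^-1 * (L%:R * s + K) @[L --> \oo] --> s)%R.
Proof.
(* Shifting the index makes the divisor [L.+1] nonzero, so that it cancels. *)
rewrite -cvg_shiftS /=.
have -> : (fun L => L.+1%:R^-1 * (L.+1%:R * s + K)) =
    (fun L => s + harmonic L * K) :> (nat -> R).
  by apply/funext => L; rewrite mulrDr mulKf ?pnatr_eq0.
have hK : harmonic L * K @[L --> \oo] --> (0 * K)%R.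
  by apply: cvgMr_tmp; exact: cvg_harmonic.
by have := cvgD (cvg_cst s) hK; rewrite mul0r addr0; exact.
Qed.

Lemma sum_ge_telescope (R : realType) (f : (\bar R)^nat) (s : R) (a : nat -> R) :
  (forall k, 0 <= f k - s%:E + (a k)%:E - (a k.+1)%:E)%E ->
  forall L, ((L%:R * s + a L - a 0%N)%:E <= \sum_(0 <= k < L) f k)%E.
Proof.
move=> f_ge; elim=> [|L IH].
  by rewrite big_geq // mul0r add0r subrr.
rewrite big_nat_recr //=.
have -> : L.+1%:R * s + a L.+1 - a 0%N =
    (L%:R * s + a L - a 0%N) + (s + a L.+1 - a L) by rewrite -natr1; ring.
rewrite EFinD; apply: leeD => //.
(* If [f L] is [+oo] the bound is trivial; [-oo] would contradict the dissipation inequality. *)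
move: (f_ge L); case: (f L) => [r| |] //=; rewrite ?leey //.
by rewrite -!EFinD !lee_fin => f_geL; lra.
Qed.

(** Replacing [a L] by its lower bound [M] in the telescoped estimate leaves an affine function of
    [L] with slope [s]. *)
Lemma limn_einf_mean_ge (R : realType) (f : (\bar R)^nat) (s M : R)
    (a : nat -> R) :
  (forall k, M <= a k) ->
  (forall k, 0 <= f k - s%:E + (a k)%:E - (a k.+1)%:E)%E ->
  (s%:E <= limn_einf (fun L => (L%:R^-1)%:E * \sum_(0 <= k < L) f k))%E.
Proof.
move=> a_ge f_ge.
(* Writing [s] as the liminf of the affine means reduces the claim to a termwise comparison. *)
have /cvg_limn_einf_sup[<- _] :
    (L%:R^-1 * (L%:R * s + (M - a 0%N)))%:E @[L --> \oo] --> s%:E.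
  by apply: cvg_EFin; [exact: nearW|exact: cvg_affine_mean].
apply: le_limn_einf => L /=.
(* [L = 0] needs no separate case: there the factor [L%:R^-1] is [0]. *)
rewrite EFinM; apply: lee_wpmul2l; first by rewrite lee_fin invr_ge0.
apply: le_trans (sum_ge_telescope _ _ _ _ f_ge L).
by rewrite lee_fin addrA lerD2r lerD2l.
Qed.

Theorem mainTheorem3 (R : realType)
    (d : measure_display) (T : measurableType d) (P : probability T R)
    (n l : nat) (A : 'M[R]_n) (B : 'M[R]_(n, l))
    (W : nat -> {RV P >-> 'cV[R]_n})
    (g : 'cV[R]_n * 'cV[R]_l -> R)
    (rho : {RV P >-> R} -> \bar R)
    (mx mu : nat) (c : 'I_mx -> 'cV[R]_n) (p : 'I_mx -> R)
    (e : 'I_mu -> 'cV[R]_l) (q : 'I_mu -> R)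
    (Xs : nat -> {RV P >-> 'cV[R]_n}) (Us : nat -> {RV P >-> 'cV[R]_l})
    (hAB : controllable A B)
    (hW : iid W)
    (g_cont : continuous g)
    (g_lb : exists M : R, forall z, M <= g z)
    (rho_gtNy : forall Y, rho Y != -oo%E)
    (rho_trans : translative rho)
    (rho_mono : monotone_risk rho)
    (rho_law : law_invariant rho)
    (hs : stationary_pair A B W rho c p e q Xs Us)
    (hs_fin : stationary_cost g Xs Us \is a fin_num)
    (hdiss : dissipative_at A B W rho c p e q g Xs Us)
    (X0 : {RV P >-> 'cV[R]_n}) (U : nat -> {RV P >-> 'cV[R]_l})
    (hU_adapted : adapted (state A B W X0 U) U)
    (hU_indep : noise_independent W (state A B W X0 U) U)
    (hcon : forall k, constraints rho c p e q (state A B W X0 U k) (U k)) :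
  (stationary_cost g Xs Us <=
   limn_einf (fun L : nat =>
     (L%:R^-1)%:E *
     \sum_(0 <= k < L) stage_cost g (state A B W X0 U k) (U k)))%E.
Proof.
have [lambda [_ [M lambda_ge] hlambda]] := hdiss.
(* The recursion clause holds by computation, as [state] at [k.+1] unfolds to [rv_step]. *)
have state_sys : system_process A B W (state A B W X0 U) U by split.
(* Finiteness turns the stationary cost into a real [s]. *)
move: hs_fin hlambda; case: (stationary_cost g Xs Us) => // s _ hlambda.
apply: (@limn_einf_mean_ge _ _ _ M (fun k => lambda (state A B W X0 U k))).
  by move=> k; exact: lambda_ge.
by move=> k; exact: hlambda state_sys k (hcon k).
Qed.
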